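(* If an infinite tournament $G=(V,E)$ is not in $\mathfrak{Out}_2$, then $G\in\mathfrak{In}_1\text{-}\mathfrak{Out}_1$.
   Context: A tournament is a digraph $G=(V,E)$ such that for any two distinct $x,y\in V$ exactly one of $(x,y),(y,x)$ is in $E$. For $W\subseteq V$, $G[W]=(W,E\cap (W\times W))$ is the induced subgraph. A set $A\subseteq V$ is independent if there is no edge (in either direction) between two distinct elements of $A$. For $n\in\mathbb N$ and $A\subseteq V$, $\mathrm{Out}^G_n(A)$ (resp. $\mathrm{In}^G_n(A)$) is the set of all $v\in V$ such that there is a directed path of length at most $n$ from some point of $A$ to $v$ (resp. from $v$ to some point of $A$); length $0$ is allowed. $G\in\mathfrak{Out}_n$ (resp. $G\in\mathfrak{In}_n$) iff there is an independent $A\subseteq V$ with $V=\mathrm{Out}^G_n(A)$ (resp. $V=\mathrm{In}^G_n(A)$). $G\in\mathfrak{In}_n\text{-}\mathfrak{Out}_k$ iff there is a partition $(V_1,V_2)$ of $V$ (parts may be empty) with $G[V_1]\in\mathfrak{In}_n$ and $G[V_2]\in\mathfrak{Out}_k$. *)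

(* Defs.v *)
From mathcomp Require Import all_boot.
From mathcomp Require Import classical_sets cardinality.

Set Implicit Arguments.
Unset Strict Implicit.
Unset Printing Implicit Defensive.

Local Open Scope classical_set_scope.

(* Loops are neither required nor excluded; no notion below depends on them. *)
Record digraph : Type := Digraph {
  vertex :> Type;
  arc : vertex -> vertex -> Prop
}.

Arguments arc : clear implicits.

Definition infinite_digraph (G : digraph) : Prop := infinite_set [set: G].

Definition tournament (G : digraph) : Prop :=
  forall x y : G, x <> y ->
    (arc G x y /\ ~ arc G y x) \/ (~ arc G x y /\ arc G y x).

Definition induced (G : digraph) (W : set G) : digraph :=
  @Digraph (set_type W) (fun x y => arc G (val x) (val y)).

Definition independent (G : digraph) (A : set G) : Prop :=
  forall x y : G, A x -> A y -> x <> y -> ~ arc G x y.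

(* The path p 0 -> p 1 -> ... -> p k has length k and pairwise distinct
   vertices; the values p i for i > k are irrelevant. *)
Definition dipath (G : digraph) (k : nat) (x y : G) : Prop :=
  exists p : nat -> G,
    [/\ p 0 = x, p k = y,
        forall i, i < k -> arc G (p i) (p i.+1)
      & forall i j, i <= k -> j <= k -> p i = p j -> i = j].

Definition Out (G : digraph) (n : nat) (A : set G) : set G :=
  [set v | exists2 a, A a & exists2 k, k <= n & dipath k a v].

Definition In (G : digraph) (n : nat) (A : set G) : set G :=
  [set v | exists2 a, A a & exists2 k, k <= n & dipath k v a].

Definition Out_class (n : nat) (G : digraph) : Prop :=
  exists2 A : set G, independent A & Out n A = [set: G].

Definition In_class (n : nat) (G : digraph) : Prop :=
  exists2 A : set G, independent A & In n A = [set: G].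

Definition In_Out_class (n k : nat) (G : digraph) : Prop :=
  exists V1 V2 : set G,
    [/\ V1 `|` V2 = [set: G], V1 `&` V2 = set0,
        In_class n (induced V1) & Out_class k (induced V2)].

(* Main.v *)
From mathcomp Require Import all_boot.
From mathcomp Require Import boolp classical_sets cardinality.
Require Import Defs.

(** A vertex [y] does not reach everything within distance 2, so some [x] is
    out of its reach. Then [x -> y], and no [v] satisfies [y -> v -> x]; hence
    every other vertex points to [y] or is pointed to by [x]. The sets
    [V1 = {y} + {v <> x | v -> y}] and its complement are the required parts. *)

Local Open Scope classical_set_scope.

Lemma dipath0 (G : digraph) (x : G) : dipath 0 x x.
Proof.
exists (fun=> x); split=> // i j.
by rewrite !leqn0 => /eqP-> /eqP->.
Qed.

Lemma dipath1 (G : digraph) (x y : G) : x <> y -> arc G x y -> dipath 1 x y.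
Proof.
move=> xy axy; exists (fun i => if i is 0 then x else y); split=> //.
- by case.
- by move=> [|[|i]] [|[|j]] // _ _ /esym.
Qed.

(** The three inequalities make the path injective, as [dipath] demands. *)
Lemma dipath2 (G : digraph) (x y z : G) : x <> y -> y <> z -> x <> z ->
  arc G x y -> arc G y z -> dipath 2 x z.
Proof.
move=> xy yz xz axy ayz.
exists (fun i => match i with 0 => x | 1 => y | _ => z end); split=> //.
- by move=> [|[|i]].
- by move=> [|[|[|i]]] [|[|[|j]]] // _ _ /esym.
Qed.

Lemma independent1 (G : digraph) (x : G) : independent [set x].
Proof. by move=> _ _ -> ->. Qed.

(** The singleton of [y] is the witness: length 0 covers [y], length 1 all other vertices. *)
Lemma In_class1_sink (G : digraph) (y : G) :
  (forall v, v <> y -> arc G v y) -> In_class 1 G.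
Proof.
move=> toy; exists [set y]; first exact: independent1.
apply/seteqP; split=> // v _; exists y => //.
have [->|vy] := EM (v = y); first by exists 0; [|exact: dipath0].
by exists 1 => //; apply: dipath1 => //; apply: toy.
Qed.

Lemma Out_class1_source (G : digraph) (x : G) :
  (forall v, v <> x -> arc G x v) -> Out_class 1 G.
Proof.
move=> fromx; exists [set x]; first exact: independent1.
apply/seteqP; split=> // v _; exists x => //.
have [->|vx] := EM (v = x); first by exists 0; [|exact: dipath0].
by exists 1 => //; apply: dipath1; [exact/nesym|exact: fromx].
Qed.

Theorem theorem3p1 (G : digraph) (hinf : infinite_digraph G)
  (htour : tournament G) (hout : ~ Out_class 2 G) : In_Out_class 1 1 G.
Proof.
have [y _] := infinite_setN0 hinf.
(* Otherwise the independent set [[set y]] would put [G] in [Out_class 2]. *)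
have [x unreached] : exists x, ~ Out 2 [set y] x.
  apply/existsNP => reached; apply: hout.
  exists [set y]; first exact: independent1.
  by apply/seteqP; split=> // v _; apply: reached.
have far k : k <= 2 -> ~ dipath k y x.
  by move=> k2 yx; apply: unreached; exists y => //; exists k.
have xy : x <> y by move=> e; apply: (far 0) => //; rewrite e; exact: dipath0.
have far2 v : v <> x -> v <> y -> arc G y v -> ~ arc G v x.
  move=> vx vy yv v_x; apply: (far 2) => //.
  by apply: (@dipath2 _ _ v) => //; exact: nesym.
(* Since [x] points to [y], it must be excluded explicitly: it is to be the source of the
   complement. *)
pose V1 := [set v | v = y \/ (v <> x /\ arc G v y)].
have V1y : V1 y by left.
have V2x : (~` V1) x by case=> // -[].
exists V1, (~` V1); split; [exact: setUv|exact: setICr| |].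
- apply: (@In_class1_sink _ (SigSub (mem_set V1y) : induced V1)) => v vy.
  have [e|[]//] := set_valP v.
  by case: vy; apply: val_inj.
- apply: (@Out_class1_source _ (SigSub (mem_set V2x) : induced (~` V1))) => v vx.
  have V1v := set_valP v; rewrite /=.
  have {}vx : val v <> x by move=> e; apply: vx; apply: val_inj.
  have vy : val v <> y by move=> e; apply: V1v; left.
  (* As [v] lies outside [V1] and differs from [x], it cannot point to [y]. *)
  have yv : arc G y (val v).
    by have [[a _]|[]//] := htour _ _ vy; case: V1v; right.
  (* An arc from [v] to [x] would complete a path of length 2 from [y] to [x]. *)
  by have [[/(far2 _ vx vy yv)]|[]] := htour _ _ vx.
Qed.
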